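(* For any graph $G$ of order $n$, $\min_{\emptyset\ne S\subseteq V(G)}|S|\,(1+\operatorname{pt}(G;S))=n$, and this minimum is achieved by $S=V(G)$.
   Context: All graphs are finite, simple and undirected, with at least one vertex (not necessarily connected). Standard zero forcing: each vertex is blue or white; if $w$ is the unique white neighbor of a blue vertex $v$, then $v$ can force $w$ (change $w$ to blue). For a nonempty set $S\subseteq V(G)$ of initially blue vertices, set $S^{[0]}=S^{(0)}=S$, let $S^{(i+1)}$ be the set of white vertices that can be forced by some vertex when exactly the vertices of $S^{[i]}$ are blue, and let $S^{[i+1]}=S^{[i]}\cup S^{(i+1)}$. The set $S$ is a zero forcing set if $S^{[p]}=V(G)$ for some $p$; then the propagation time $\operatorname{pt}(G;S)$ is the least such $p\ge 0$ (so $\operatorname{pt}(G;V(G))=0$). If $S$ is not a zero forcing set, $\operatorname{pt}(G;S)=\infty$. *)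

(* Defs.v *)
From mathcomp Require Import all_boot all_order all_algebra.
From mathcomp Require Import boolp constructive_ereal.

Set Implicit Arguments.
Unset Strict Implicit.
Unset Printing Implicit Defensive.

Import Order.TTheory GRing.Theory Num.Theory.

(* A graph is an adjacency relation [e] on a finite vertex type [T]; symmetry
   and irreflexivity of [e] are hypotheses of the theorem. *)
Section ZeroForcing.
Variables (T : finType) (e : rel T).
Implicit Types (S B : {set T}).

(* The set of neighbors of [v] outside [B] is [[set w]] exactly when [w] is the
   unique white neighbor of [v], so in particular [w] itself is white. *)
Definition can_force B (v w : T) : bool :=
  (v \in B) && ([set u | e v u] :\: B == [set w]).

Definition forced B : {set T} := [set w | [exists v, can_force B v w]].

(* [blue S i] is S^{[i]}, and [forced (blue S i)] is S^{(i+1)}. *)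
Fixpoint blue S (i : nat) : {set T} :=
  if i is j.+1 then blue S j :|: forced (blue S j) else S.

Definition zero_forcing S : Prop := exists p, blue S p == [set: T].

Definition pt S : \bar int :=
  if pselect (zero_forcing S) is left zfS then ((ex_minn zfS)%:Z)%:E
  else +oo%E.

End ZeroForcing.

(* Main.v *)
(* Call a blue vertex active if it still has a white neighbor. A vertex that
   forces becomes inactive, and each newly forced vertex has its own forcer, so
   the number of active vertices never exceeds [#|S|]; hence each step colors at
   most [#|S|] vertices and [#|S^{[p]}| <= #|S| * (1 + p)]. *)

Require Import Defs.
From mathcomp Require Import all_boot all_order all_algebra.
From mathcomp Require Import boolp constructive_ereal.

Set Implicit Arguments.
Unset Strict Implicit.
Unset Printing Implicit Defensive.

Import Order.TTheory GRing.Theory Num.Theory.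

Section Active.
Variables (T : finType) (e : rel T).
Implicit Types (S B : {set T}).

Definition active B : {set T} := [set v in B | [set u | e v u] :\: B != set0].

Definition forcers B : {set T} := [set v | [exists w, can_force e B v w]].

Lemma forcers_sub_active B : forcers B \subset active B.
Proof.
apply/subsetP => v; rewrite !inE => /existsP[w /andP[-> /eqP->]] /=.
by apply/set0Pn; exists w; rewrite inE.
Qed.

(** A forcer has a single white neighbor, and sending each forcer to it covers [forced e B]. The
    inequality can be strict, since several vertices may be able to force the same one. *)
Lemma card_forced_le B : #|forced e B| <= #|forcers B|.
Proof.
(* The default [v] is a filler for vertices outside [forcers B]. *)
pose target v := odflt v [pick w | can_force e B v w].
apply: leq_trans (leq_imset_card target (forcers B)).
apply/subset_leq_card/subsetP => w; rewrite inE => /existsP[v vw].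
apply/imsetP; exists v; first by rewrite inE; apply/existsP; exists w.
rewrite /target; case: pickP => [u /andP[_ /eqP vu] | /(_ w)]; last by rewrite vw.
by case/andP: vw => _; rewrite vu => /eqP/set1_inj.
Qed.

(** More blue cannot activate a vertex that is already blue, and a forcer loses its last white
    neighbor; only newly blue vertices can join. *)
Lemma active_step_sub B :
  active (B :|: forced e B) \subset (active B :\: forcers B) :|: forced e B.
Proof.
apply/subsetP => v; rewrite inE => /andP[vB' /set0Pn[u]].
rewrite in_setD in_setU negb_or => /andP[/andP[uB uF]].
rewrite in_set => vu; move: vB'; rewrite !in_setU.
case: (boolP (v \in forced e B)) => [_ | _]; first by rewrite !orbT.
rewrite !orbF in_setD => vB; apply/andP; split.
  (* [u] stays white through the step; if [v] were a forcer, its unique white neighbor would be [u],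
     which would then be forced. *)
  apply: contra uF; rewrite inE => /existsP[w vw].
  have /andP[_ /eqP Ew] := vw.
  have : u \in [set w] by rewrite -Ew !inE uB.
  by rewrite inE => /eqP->; rewrite inE; apply/existsP; exists v.
by rewrite inE vB; apply/set0Pn; exists u; rewrite !inE uB.
Qed.

Lemma card_active_step B : #|active (B :|: forced e B)| <= #|active B|.
Proof.
apply: leq_trans (subset_leq_card (active_step_sub B)) _.
apply: leq_trans (leq_card_setU _ _) _.
rewrite cardsDS ?forcers_sub_active //.
(* Splitting off the forcers on the right leaves only forced against forcers to compare. *)
rewrite -[leqRHS](subnK (subset_leq_card (forcers_sub_active B))).
by rewrite leq_add2l card_forced_le.
Qed.

Lemma card_active_blue S i : #|active (blue e S i)| <= #|S|.
Proof.
elim: i => [|i IHi] /=; last exact: leq_trans (card_active_step _) IHi.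
by apply/subset_leq_card/subsetP => v; rewrite inE => /andP[].
Qed.

Lemma card_blue_le S i : #|blue e S i| <= #|S| * i.+1.
Proof.
elim: i => [|i IHi] /=; first by rewrite muln1.
apply: leq_trans (leq_card_setU _ _) _; rewrite mulnSr leq_add //.
apply: leq_trans (card_forced_le _) _.
apply: leq_trans (subset_leq_card (forcers_sub_active _)) _.
exact: card_active_blue.
Qed.

Lemma pt_setT : pt e [set: T] = 0%E.
Proof.
rewrite /pt; case: pselect => [zfT | []]; last by exists 0; rewrite /= eqxx.
case: ex_minnP => m _ /(_ 0); rewrite /= eqxx leqn0 => /(_ isT)/eqP -> //.
Qed.

Lemma card_le_mul_pt S : S != set0 ->
  ((#|T|%:Z)%:E <= (#|S|%:Z)%:E * (1 + pt e S))%E.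
Proof.
rewrite -card_gt0 => S_gt0; rewrite /pt; case: pselect => [zfS | _]; last first.
  (* Nonemptiness of [S] matters here: [0 * +oo] is [0], whereas a positive factor gives [+oo]. *)
  by rewrite addey // gt0_muley ?leey // lte_fin ltz_nat.
case: ex_minnP => p /eqP blueT _.
rewrite -EFinD -EFinM lee_fin -PoszD -PoszM lez_nat add1n -cardsT -blueT.
exact: card_blue_le.
Qed.

End Active.

Theorem mainTheorem2 (T : finType) (e : rel T)
    (e_sym : symmetric e) (e_irr : irreflexive e)
    (n : nat) (n_gt0 : (0 < n)%N) (order_n : #|T| = n) :
  (\big[Order.min/+oo]_(S : {set T} | S != set0)
      ((#|S|%:Z)%:E * (1 + pt e S)) = (n%:Z)%:E)%E
  /\ [set: T] != set0
  /\ (((#|[set: T]|%:Z)%:E * (1 + pt e [set: T])) = (n%:Z)%:E)%E.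
Proof.
have T_neq0 : [set: T] != set0 by rewrite -card_gt0 cardsT order_n.
have ET : (((#|[set: T]|%:Z)%:E * (1 + pt e [set: T])) = (n%:Z)%:E)%E.
  by rewrite pt_setT adde0 mule1 cardsT order_n.
split; last by split.
apply/le_anti/andP; split; first by rewrite -ET; apply: bigmin_le_cond.
(* The lower bound must hold for the default [+oo] of the minimum as well as for each nonempty
   [S]. *)
apply/bigmin_geP; split => [|S S_neq0]; first exact: leey.
by rewrite -order_n card_le_mul_pt.
Qed.
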